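(* Let $L\supseteq K$ be a field extension with $[L:K]<\infty$, and let $G:=\mathrm{Aut}(L,K)$ be the group of all field automorphisms of $L$ that fix every element of $K$. Then the following conditions are equivalent. (a) $|G|=[L:K]$. (b) $L$ is a splitting field over $K$ for some polynomial $0\neq f\in K[X]$ which does not have multiple roots in $L$. (c) $K=\{y\in L\mid \sigma(y)=y\text{ for all }\sigma\in G\}$.
   Context: $[L:K]$ denotes the degree of the extension, i.e. the dimension of $L$ as a $K$-vector space. No assumption is made on the characteristic of the fields. Since $[L:K]<\infty$, the group $G$ is automatically finite. *)

(* Defs.v *)
From HB Require Import structures.
From mathcomp Require Import all_boot all_order all_algebra all_field.

Set Implicit Arguments.
Unset Strict Implicit.
Unset Printing Implicit Defensive.

Import GRing.Theory.
Local Open Scope ring_scope.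

(* A finite extension L of K is a [L : fieldExtType K]; K sits in L as the
   line 1%VS = { a%:A | a : K }, and [L : K] is \dim {:L}. *)

(* ['Gal(E / K)] is only available when L is normal over K, whereas L is
   arbitrary here; [kAut] has no such restriction.  An additive map fixing K
   and multiplicative on L is K-linear, so nothing is lost by looking for the
   automorphisms in ['End(L)]: see [autP] and [aut_ofP]. *)
Definition aut (K : fieldType) (L : fieldExtType K) : Type :=
  {s : 'End(L) | kAut 1 {:L} s}.

Definition has_card (T : Type) (n : nat) : Prop :=
  exists f : 'I_n -> T, bijective f.

Definition no_multiple_roots_in (K : fieldType) (L : fieldExtType K)
    (f : {poly K}) : Prop :=
  forall x : L, (mup x (map_poly (in_alg L) f) <= 1)%N.

Lemma autP (K : fieldType) (L : fieldExtType K) (s : aut L) :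
  [/\ bijective (val s), zmod_morphism (val s), monoid_morphism (val s)
    & forall a : K, val s a%:A = a%:A].
Proof.
case: s => s /= /andP[homs _].
have /kHom_monoid_morphism sM := homs.
have [s1 sMul] := sM.
have injs : injective s.
  move=> x y /eqP; rewrite -subr_eq0 -linearB => /eqP sxy0.
  apply/eqP; rewrite -subr_eq0; apply: contraT => nz.
  have := sMul (x - y) (x - y)^-1.
  by rewrite divff // s1 sxy0 mul0r => /eqP; rewrite oner_eq0.
split=> //; last by move=> a; rewrite linearZ /= s1.
- have ks : lker s == 0%VS by apply/lker0P.
  by exists (s^-1)%VF; [apply: lker0_lfunK | apply: lker0_lfunVK].
- by move=> x y; rewrite linearB.
Qed.

Lemma aut_ofP (K : fieldType) (L : fieldExtType K) (s : L -> L) :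
  bijective s -> zmod_morphism s -> monoid_morphism s ->
  (forall a : K, s a%:A = a%:A) -> exists! t : aut L, val t =1 s.
Proof.
move=> [s' sK s'K] sB [s1 sM] sfix.
have sZ : scalable s.
  by move=> a x; rewrite -mulr_algl sM sfix mulr_algl.
pose sA := GRing.isZmodMorphism.Build L L s sB.
pose sS := GRing.isScalable.Build K L L *:%R s sZ.
pose sL : {linear L -> L} := HB.pack s sA sS.
have tE : linfun sL =1 s by move=> x; rewrite lfunE.
have kt : kAut 1 {:L} (linfun sL).
  apply/andP; split.
    by apply/kHom_monoid_morphism; split=> [|x y]; rewrite !tE.
  rewrite eqEsubv subvf /=; apply/subvP=> y _.
  by rewrite -[y]s'K -tE memv_img ?memvf.
exists (exist (fun s : 'End(L) => kAut 1 {:L} s) _ kt); split=> // t' t'E.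
by apply: val_inj; apply/lfunP=> x; rewrite /= tE t'E.
Qed.

(* Main.v *)
(** Enumerate G = Aut(L, K) and let F be its fixed field.  For x in L, the
    product of the X - y over the G-orbit of x has coefficients in F and divides
    the minimal polynomial of x over F, so it is that polynomial.  Hence L is
    separable over F, so L = F(a) for some a; an automorphism is determined by
    its value at a, so [L : F] = |orbit of a| = |G| and [L : K] = |G| [F : K].
    Therefore (a) and (c) both say F = K, and then the minimal polynomial of a
    over K witnesses (b).  That (b) implies (c) is Galois theory for the
    splitting field L. *)

Require Import Defs.
From HB Require Import structures.
From mathcomp Require Import all_boot all_order all_algebra all_field.
From Stdlib Require Import Classical.

Set Implicit Arguments.
Unset Strict Implicit.
Unset Printing Implicit Defensive.

Import GRing.Theory.
Local Open Scope ring_scope.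

(* Only classically: root finding over an abstract field is undecidable. *)
Lemma seq_roots (R : idomainType) (p : {poly R}) :
  p != 0 -> exists rs : seq R, forall x, root p x -> x \in rs.
Proof.
move=> nz_p; apply: NNPP => no_rs.
have long m : exists2 rs, all (root p) rs && uniq rs & size rs = m.
  elim: m => [|m [rs /andP[rt_rs uniq_rs] sz_rs]]; first by exists [::].
  apply: NNPP => no_x; case: no_rs; exists rs => x px.
  apply: contraT => rs'x; case: no_x; exists (x :: rs); last by rewrite /= sz_rs.
  by rewrite /= px rt_rs rs'x.
have [rs /andP[rt_rs uniq_rs] sz_rs] := long (size p).
by have := max_poly_roots nz_p rt_rs uniq_rs; rewrite sz_rs ltnn.
Qed.

Section Automorphisms.

Variables (K : fieldType) (L : fieldExtType K).
Implicit Types (g h : 'AEnd(L)) (x : L) (G : seq 'AEnd(L)).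

(** An endomorphism is determined by its values on a basis and sends each basis vector to a root of
    that vector's minimal polynomial. All these roots lie in one finite list, which leaves finitely
    many candidates. *)
Lemma finite_AEnd : exists2 G, uniq G & forall g, g \in G.
Proof.
pose b : seq L := vbasis {:L}; pose p := \prod_(x <- b) minPoly 1 x.
have nz_p: p != 0 by apply/monic_neq0/monic_prod => x _; apply: monic_minPoly.
have [rs p_rs] := seq_roots nz_p.
have g_rs g x : x \in b -> g x \in rs.
  move=> b_x; apply: p_rs; rewrite /p (big_rem x) //= rootM.
  rewrite (kHom_root_id (sub1v {:L}%AS) (k1AHom _ g)) ?root_minPoly //.
    exact: minPolyOver.
  exact: memvf.
(* [lin t] sends the [i]-th vector of [b] to [t i]; [S] keeps those linear maps that are algebra
   morphisms. *)
pose lin (t : {ffun 'I_(size b) -> seq_sub rs}) : 'End(L) :=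
  linfun (sval (linear_of_free b [seq val (t i) | i <- enum 'I_(size b)])).
pose S := pmap (insub : _ -> option 'AEnd(L)) (map lin (enum predT)).
exists (undup S) => [|g]; first exact: undup_uniq.
rewrite mem_undup mem_pmap_sub /=.
have b_nth (i : 'I_(size b)) : b`_i \in b by rewrite mem_nth.
apply/mapP; exists [ffun i : 'I_(size b) => SeqSub (g_rs g _ (b_nth i))].
  by rewrite mem_enum.
rewrite /lin; case: linear_of_free => f /= Df.
have bas: basis_of {:L} b := vbasisP _.
move/(_ (basis_free bas)) in Df.
have {}Df: map f b = map g b.
  set fb := (X in size X = _ -> _) in Df.
  have sz_fb: size fb = size b by rewrite size_map size_enum_ord.
  rewrite (Df sz_fb).
  apply: (@eq_from_nth _ 0) => [|i]; rewrite sz_fb ?size_map // => lt_i.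
  rewrite (nth_map (Ordinal lt_i)) ?size_enum_ord // ffunE /= nth_enum_ord //.
  by rewrite (nth_map 0).
apply/lfunP=> x; rewrite lfunE /=.
have: x \in <<b>>%VS by rewrite (span_basis bas) memvf.
move=> /(@coord_span _ _ _ (in_tuple b))->; rewrite !linear_sum.
apply: eq_bigr => i _; rewrite !linearZ /=; congr (_ *: _).
by have /(congr1 (nth 0 ^~ i)) := Df; rewrite !(nth_map 0).
Qed.

Variable G : seq 'AEnd(L).
Hypothesis memG : forall g, g \in G.

Definition autFixed : {vspace L} := (\bigcap_(g <- G) fixedSpace g)%VS.

Lemma autFixedP x : reflect (forall g, g x = x) (x \in autFixed).
Proof.
apply: (iffP idP) => [Fx g | fix_x].
  apply/fixedSpaceP; move: Fx; rewrite /autFixed (big_rem _ (memG g)) /=.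
  by rewrite memv_cap => /andP[].
rewrite /autFixed; elim/big_rec: _ => [|g V _ Vx]; first exact: memvf.
by rewrite memv_cap Vx andbT; apply/fixedSpaceP.
Qed.

Fact autFixed_is_aspace : is_aspace autFixed.
Proof.
rewrite /autFixed; elim/big_rec: _ => [|g V _ asV]; first exact: (valP {:L}%AS).
exact: (valP (fixedSpace g :&: ASpace asV)%AS).
Qed.
Canonical autFixed_aspace : {subfield L} := ASpace autFixed_is_aspace.

Let F := autFixed_aspace.
(** Duplicates are removed so that the product of the ['X - y%:P] over the orbit is separable. *)
Definition autOrbit x := undup [seq g x | g : 'AEnd(L) <- G].

Lemma minPoly_autFixed x :
  minPoly F x = \prod_(y <- autOrbit x) ('X - y%:P).
Proof.
have uniq_o := undup_uniq [seq g x | g : 'AEnd(L) <- G].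
have mem_o g : g x \in autOrbit x by rewrite mem_undup; apply/mapP; exists g.
(* [g] is injective and maps the finite orbit into itself, so it permutes the factors of the product
   and fixes its coefficients. *)
have orbit_stable g : perm_eq [seq g y | y <- autOrbit x] (autOrbit x).
  have Ug: uniq [seq g y | y <- autOrbit x].
    by rewrite map_inj_uniq //; apply: fmorph_inj.
  have sub_o: {subset [seq g y | y <- autOrbit x] <= autOrbit x}.
    move=> _ /mapP[y + ->]; rewrite [y \in _]mem_undup => /mapP[h _ ->].
    by have := mem_o (g \o h)%AF; rewrite comp_lfunE.
  by apply: uniq_perm => //; apply: (uniq_min_size Ug sub_o _).2; rewrite size_map.
apply/eqP; rewrite -eqp_monic ?monic_minPoly ?monic_prod_XsubC //.
apply/andP; split.
  apply: minPoly_dvdp; last first.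
    by rewrite root_prod_XsubC -[X in X \in _](id_lfunE x) (mem_o \1%AF).
  apply/polyOverP=> i; apply/autFixedP => g; rewrite -coef_map rmorph_prod /=.
  congr (_ : {poly _})`_i; rewrite -[RHS](perm_big _ (orbit_stable g)) big_map.
  by apply: eq_bigr => y _; rewrite rmorphB /= map_polyX map_polyC.
(* Conversely, [g] fixes [F] pointwise, so each [g x] is a root of [minPoly F x]; distinct roots
   give divisibility by the product. *)
rewrite uniq_roots_dvdp ?uniq_rootsE //; apply/allP=> y.
rewrite mem_undup => /mapP[g _ ->].
have homFg: kHom F {:L} g by apply/kAHomP => z /autFixedP.
by rewrite (kHom_root_id (subvf F) homFg) ?minPolyOver ?memvf ?root_minPoly.
Qed.

Lemma autFixed_generator : exists a, <<F; a>>%VS = {:L}%VS.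
Proof.
exists (separable_generator F {:L}); apply/esym/eq_adjoin_separable_generator.
  apply/separableP => y _.
  by rewrite /separable_element minPoly_autFixed separable_prod_XsubC undup_uniq.
exact: subvf.
Qed.

Lemma size_autOrbit_generator a :
  uniq G -> <<F; a>>%VS = {:L}%VS -> size (autOrbit a) = size G.
Proof.
move=> uniqG Fa; rewrite /autOrbit undup_id ?size_map //.
rewrite map_inj_uniq // => g h eq_gh; apply/val_inj/lfunP => x.
have: x \in <<F; a>>%VS by rewrite Fa memvf.
(* Every [x] is a polynomial in [a] whose coefficients are fixed by both [g] and [h]. *)
case/Fadjoin_polyP => p /polyOverP Fp ->; rewrite -!horner_map /= eq_gh.
congr _.[_]; apply/polyP => i; rewrite !coef_map /=.
by have /autFixedP Fpi := Fp i; rewrite !Fpi.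
Qed.

Lemma dim_autFixed : uniq G -> \dim {:L} = (size G * \dim F)%N.
Proof.
move=> uniqG; have [a Fa] := autFixed_generator.
rewrite -(size_autOrbit_generator uniqG Fa) -[in LHS]Fa (dim_Fadjoin F a).
(* The size of a polynomial is its degree plus one. *)
congr (_ * _)%N; apply: succn_inj.
by rewrite -size_minPoly minPoly_autFixed size_prod_XsubC.
Qed.

End Automorphisms.

(** As [f] splits over [L], the multiplicity of [x] counts its occurrences in the list of roots; the
    bound by one makes that list duplicate-free. *)
Lemma separable_map_split (K : fieldType) (L : fieldExtType K) (f : {poly K})
    (U V : {vspace L}) :
  f != 0 -> splittingFieldFor U (map_poly (in_alg L) f) V ->
  no_multiple_roots_in L f -> separable_poly (map_poly (in_alg L) f).
Proof.
move=> nz_f [rs Df _] simple; rewrite (eqp_separable Df) separable_prod_XsubC.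
apply: count_mem_uniq => x; apply/eqP.
have := simple x; rewrite mup_leq ?map_poly_eq0 // (eqp_dvdr _ Df).
rewrite -mup_leq ?monic_neq0 ?monic_prod_XsubC // mu_prod_XsubC.
by rewrite -has_pred1 has_count; case: count => [|[]].
Qed.

Lemma separable_no_multiple_roots (K : fieldType) (L : fieldExtType K)
    (f : {poly K}) :
  separable_poly (map_poly (in_alg L) f) -> no_multiple_roots_in L f.
Proof.
move=> sep_f x; rewrite mup_leq; last exact: separable_poly_neq0.
by rewrite (separable_nosquare sep_f) // size_XsubC.
Qed.

(** A field endomorphism is injective and, by finite dimension, onto. *)
Lemma aut_ahom (K : fieldType) (L : fieldExtType K) (s : 'End(L)) :
  kAut 1 {:L} s = ahom_in {:L} s.
Proof. by rewrite kAutfE k1HomE. Qed.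

Lemma has_card_aut (K : fieldType) (L : fieldExtType K) (G : seq 'AEnd(L)) n :
  uniq G -> (forall g, g \in G) -> has_card (aut L) n <-> n = size G.
Proof.
move=> uniqG memG.
have kAut_AEnd (g : 'AEnd(L)) : kAut 1 {:L} g by rewrite aut_ahom (valP g).
pose phi (i : 'I_(size G)) : aut L := 
    exist (fun s : 'End(L) => kAut 1 {:L} s) _ (kAut_AEnd (nth \1%AF G i)).
have bij_phi : bijective phi.
  have ahom_aut (s : aut L) : ahom_in {:L} (val s) by rewrite -aut_ahom (valP s).
  have idx (s : aut L) : (index (AHom (ahom_aut s)) G < size G)%N.
    by rewrite index_mem.
  exists (fun s => Ordinal (idx s)) => [i | s]; apply/val_inj => /=.
    rewrite -[RHS](index_uniq \1%AF (ltn_ord i) uniqG); congr (index _ _).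
  by rewrite nth_index.
split=> [[f [f' fK f'K]] | ->]; last by exists phi.
have [phi' phiK phi'K] := bij_phi.
have: bijective (phi' \o f).
  by exists (f' \o phi) => x /=; rewrite ?phi'K ?fK ?f'K ?phiK.
by move/bij_eq_card; rewrite !card_ord.
Qed.

(** A separable splitting polynomial makes [L] Galois over [K], and every element of the Galois
    group is a [K]-automorphism, so it fixes [y]. *)
Lemma splitting_fixed (K : fieldType) (L : splittingFieldType K) (p : {poly L})
    (y : L) :
  p \is a polyOver 1%VS -> separable_poly p -> splittingFieldFor 1 p {:L} ->
  (forall s : aut L, val s y = y) -> y \in 1%VS.
Proof.
move=> p1 sep_p split_p fix_y.
have /galois_fixedField gal1: galois 1 {:L}.
  by apply/splitting_galoisField; exists p.
rewrite -[1%VS]gal1; apply/fixedFieldP; rewrite ?memvf // => x.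
rewrite gal_kAut ?sub1v // => autx.
exact: (fix_y (exist (fun s : 'End(L) => kAut 1 {:L} s) _ autx)).
Qed.

Theorem theorem1 (K : fieldType) (L : fieldExtType K) :
  [<-> has_card (aut L) (\dim {:L});
       exists f : {poly K},
         [/\ f != 0,
             splittingFieldFor 1 (map_poly (in_alg L) f) {:L}
           & no_multiple_roots_in L f];
       forall y : L,
         y \in 1%VS <-> (forall s : aut L, val s y = y)].
Proof.
have [G uniqG memG] := finite_AEnd L; pose F := autFixed_aspace G.
have dimF: \dim {:L} = (size G * \dim F)%N := dim_autFixed memG uniqG.
have G_gt0: (0 < size G)%N by rewrite -has_predT; apply/hasP; exists \1%AF.
tfae.
- move/(has_card_aut _ uniqG memG) => cardL.
  (* Cancelling [size G] in [dimF] leaves [\dim F] equal to 1. *)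
  have /eqP F1: 1%VS == F :> {vspace L}.
    by rewrite eqEdim sub1v dimv1 -(leq_pmul2l G_gt0) -dimF muln1 cardL leqnn.
  have [a] := autFixed_generator memG; rewrite -/F => Fa.
  have := minPoly_autFixed memG a; rewrite -/F => Da.
  have /polyOver1P[f Df]: minPoly F a \is a polyOver 1%VS.
    by rewrite [1%VS]F1 minPolyOver.
  have sep_f: separable_poly (map_poly (in_alg L) f).
    by rewrite -Df Da separable_prod_XsubC undup_uniq.
  exists f; split; last exact: separable_no_multiple_roots.
    by rewrite -(map_poly_eq0 (in_alg L)) separable_poly_neq0.
  exists (autOrbit G a); first by rewrite -Df Da eqpxx.
  (* The orbit contains [a], so adjoining it to [F] already gives [L]. *)
  rewrite [1%VS]F1; apply/eqP; rewrite eqEsubv subvf -[X in (X <= _)%VS]Fa.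
  apply/FadjoinP; split; first exact: subv_adjoin_seq.
  by rewrite seqv_sub_adjoin // -root_prod_XsubC -Da root_minPoly.
- move=> [f [nz_f split_f simple_f]] y; split=> [/vlineP[a ->] s|].
    by have [_ _ _ ->] := autP s.
  have f1: map_poly (in_alg L) f \is a polyOver 1%VS := alg_polyOver 1%AS f.
  (* Condition (b) itself equips [L] with the splitting field structure that Galois theory
     requires. *)
  have axL : SplittingField.axiom L by exists (map_poly (in_alg L) f).
  pose LS : splittingFieldType K :=
    HB.pack (FieldExt.sort L) (FieldExt_isSplittingField.Build K L axL).
  apply: (@splitting_fixed K LS _ y f1 _ split_f).
  exact: separable_map_split split_f simple_f.
- move=> fixed; apply/(has_card_aut _ uniqG memG).
  have F1: F = 1%VS :> {vspace L}.
    apply/vspaceP => y; apply/(autFixedP memG)/idP => [fix_y | /vlineP[a ->] g].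
      apply/fixed => s; have ahom_s: ahom_in {:L} (val s).
        by rewrite -aut_ahom (valP s).
      exact: (fix_y (AHom ahom_s)).
    exact: rmorph_alg.
  by rewrite dimF F1 dimv1 muln1.
Qed.
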